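(* Let $X_1,X_2$ be compact metric spaces and $E_1,E_2$ complex Banach spaces. Let $U:(\operatorname{Lip}(X_1,E_1),\|\cdot\|_L) \to (\operatorname{Lip}(X_2,E_2),\|\cdot\|_L)$ be a surjective complex linear isometry. Suppose that there are a surjective complex linear isometry $\psi:E_1\to E_2$ and a surjective isometry $\varphi:X_2 \to X_1$ such that \[ U(f \otimes e)(y)=\psi(f(\varphi(y))e) \] for all $f \in \operatorname{Lip}(X_1)$, $e \in E_1$ and $y\in X_2$. Then \[ (UF)(y)=\psi(F(\varphi(y))) \] for all $F \in \operatorname{Lip}(X_1,E_1)$ and $y\in X_2$.
   Context: Metric spaces are nonempty. For a compact metric space $(X,d)$ and a complex Banach space $(E,\|\cdot\|_E)$, $\operatorname{Lip}(X,E)$ is the space of all maps $F:X\to E$ with $L(F):=\sup_{x\neq y\in X}\frac{\|F(x)-F(y)\|_E}{d(x,y)}<\infty$ (with $L(F)=0$ if $X$ is a single point). It is a Banach space with the sum norm $\|F\|_L=\sup_{x\in X}\|F(x)\|_E+L(F)$. $\operatorname{Lip}(X)=\operatorname{Lip}(X,\mathbb{C})$. For $f\in\operatorname{Lip}(X)$ and $e\in E$, $f\otimes e\in\operatorname{Lip}(X,E)$ is defined by $(f\otimes e)(x)=f(x)e$. A surjective isometry between metric spaces is a surjective distance-preserving map. *)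

(* Defs.v *)
From HB Require Import structures.
From mathcomp Require Import all_boot all_order all_algebra.
From mathcomp Require Import complex.
From mathcomp Require Import all_classical all_reals topology normedtype.

Set Implicit Arguments.
Unset Strict Implicit.
Unset Printing Implicit Defensive.

Import Order.TTheory GRing.Theory Num.Theory.
Import numFieldNormedType.Exports.

Local Open Scope classical_set_scope.
Local Open Scope ring_scope.

(* Norms on an R[i]-normed module take their values in R[i]; they are
   nonnegative reals there, and [rnorm] is the same norm read in R, where
   suprema can be taken. *)
Definition rnorm {R : realType} {E : normedModType R[i]} (v : E) : R :=
  complex.Re `|v|.

Section RealNorm.
Context {R : realType} {E : normedModType R[i]}.
Implicit Types v w : E.

Lemma rnormE v : (rnorm v)%:C%C = `|v|.
Proof. exact/RRe_real/normr_real. Qed.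

Lemma rnorm_ge0 v : 0 <= rnorm v.
Proof. by rewrite -lecR rnormE; exact: normr_ge0. Qed.

Lemma rnorm0 : rnorm (0 : E) = 0.
Proof. by rewrite /rnorm normr0. Qed.

Lemma ler_rnormD v w : rnorm (v + w) <= rnorm v + rnorm w.
Proof. by rewrite -lecR rmorphD /= !rnormE ler_normD. Qed.

Lemma rnormZ (a : R[i]) v : rnorm (a *: v) = rnorm (a : R[i]^o) * rnorm v.
Proof. by apply: complexI; rewrite rmorphM /= !rnormE normrZ. Qed.

End RealNorm.

Section Lipschitz.
Context {R : realType} {X : metricType R} {E : normedModType R[i]}.
Implicit Types F G : X -> E.

Definition slopes F : set R :=
  [set r | exists x y : X, x <> y /\ r = rnorm (F x - F y) / mdist x y].

(* On a one-point space there are no slopes, and [sup set0 = 0]. *)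
Definition lip_const F : R := sup (slopes F).

Definition lip_pred : {pred (X -> E)} := [pred F | `[< has_ubound (slopes F) >]].

Lemma lip_predP F :
  reflect (exists M, forall x y, rnorm (F x - F y) <= M * mdist x y)
          (F \in lip_pred).
Proof.
apply: (iffP (asboolP (has_ubound (slopes F)))) => -[M FM].
  exists M => x y; have [->|/eqP xy] := eqVneq x y.
    by rewrite subrr rnorm0 mdistxx mulr0.
  rewrite -ler_pdivrMr ?mdist_gt0; last exact/eqP.
  by apply: FM; exists x, y.
exists M => _ [x [y [xy ->]]].
by rewrite ler_pdivrMr ?mdist_gt0//; exact/eqP.
Qed.

Lemma lip_submod_closed : submod_closed lip_pred.
Proof.
split; first by apply/lip_predP; exists 0 => x y; rewrite subrr rnorm0 mul0r.
move=> a F G /lip_predP[M FM] /lip_predP[N GN]; apply/lip_predP.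
exists (rnorm (a : R[i]^o) * M + N) => x y.
have -> : (a *: F + G) x - (a *: F + G) y = a *: (F x - F y) + (G x - G y).
  by rewrite !fctE opprD addrACA scalerBr.
rewrite (le_trans (ler_rnormD _ _))// mulrDl lerD// rnormZ -mulrA.
by rewrite ler_wpM2l ?rnorm_ge0.
Qed.

HB.instance Definition _ :=
  GRing.isSubmodClosed.Build R[i] (X -> E) lip_pred lip_submod_closed.

End Lipschitz.

Record lip {R : realType} (X : metricType R) (E : normedModType R[i]) := Lip {
  lip_fun :> X -> E ;
  _ : lip_fun \in lip_pred
}.

Section LipSpace.
Context {R : realType} {X : metricType R} {E : normedModType R[i]}.

HB.instance Definition _ := [isSub for @lip_fun R X E].
HB.instance Definition _ := [Choice of lip X E by <:].
HB.instance Definition _ := [SubChoice_isSubLmodule of lip X E by <:].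

(* For compact X a Lipschitz map is bounded, so the first [sup] is a genuine
   supremum of a bounded set. *)
Definition lip_norm (F : lip X E) : R :=
  sup [set rnorm (F x) | x in [set: X]] + lip_const F.

Lemma lip_tensor_subproof (f : lip X R[i]^o) (e : E) :
  (fun x => f x *: e) \in lip_pred.
Proof.
case: f => f /= /lip_predP[M fM]; apply/lip_predP.
exists (M * rnorm e) => x y; rewrite -scalerBl rnormZ mulrAC.
by rewrite ler_wpM2r ?rnorm_ge0.
Qed.

Definition lip_tensor (f : lip X R[i]^o) (e : E) : lip X E :=
  Lip (lip_tensor_subproof f e).

End LipSpace.

(* Main.v *)
(* Adding a constant to a Lipschitz map changes its sup norm but not its
   Lipschitz constant, so for a linear isometry U fixing the constants (up to
   psi) the differences |H + c|_oo - |H + c'|_oo are preserved.  Suppose that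
   U F y0 - psi (F (phi y0)) = psi e with e <> 0, put x0 = phi y0, and perturb
   F by f (x) e, where f = - K (1 + i) d(., x0) with K large.  Since both the
   real and the imaginary part of f have a sharp maximum at x0, for large s
   the sup norms for c = s e and c = i s e are both s |e|, attained at x0, when
   H = F - F x0 + f (x) e; but for the image of H under U they are at least
   (s + 1) |e| and at most (s + 1/2) |e| respectively, a contradiction. *)

Require Import Defs.
From HB Require Import structures.
From mathcomp Require Import all_boot all_order all_algebra.
From mathcomp Require Import complex ring lra.
From mathcomp Require Import all_classical all_reals topology normedtype.

Set Implicit Arguments.
Unset Strict Implicit.
Unset Printing Implicit Defensive.

Import Order.TTheory GRing.Theory Num.Theory.
Import numFieldNormedType.Exports.

Local Open Scope classical_set_scope.
Local Open Scope ring_scope.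

Lemma subrDZ (K : pzRingType) (V : lmodType K) (a b : K) (g h v : V) :
  (g + a *: v) - (h + b *: v) = g - h + (a - b) *: v.
Proof. by rewrite opprD addrACA -scalerBl. Qed.

Section LipschitzMaps.
Context {R : realType} {X : metricType R} {E : normedModType R[i]}.

(** Near-covering compactness along [+oo]: on the unit ball around [x] the triangle inequality gives
    the bound [1 + mdist x x0]. *)
Lemma compact_mdist_bounded (x0 : X) :
  compact [set: X] -> exists D, forall x, mdist x x0 <= D.
Proof.
move=> /compact_near_coveringP/(_ R +oo (fun r x => mdist x x0 <= r)) cX.
have [x _|D [_ DX]] := cX _; last first.
  (* Neighbourhoods of [+oo] contain open rays, so [D] itself may fail. *)
  by exists (D + 1) => x; apply: (DX (D + 1)) => //; rewrite ltrDl.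
exists (ball x 1, [set r | 1 + mdist x x0 <= r]) => /=.
  split; first exact: nbhsx_ballx.
  by apply: nbhs_pinfty_ge; rewrite num_real.
move=> [x' r] /= [+ xr]; rewrite ballEmdist /= => xx'.
rewrite (le_trans (metric_triangle _ x _))// (le_trans _ xr)// lerD2r.
by rewrite metric_sym ltW.
Qed.

Lemma lipDE (F G : lip X E) x : (F + G) x = F x + G x.
Proof. by []. Qed.

Lemma lip_bound (F : lip X E) : exists2 M, 0 <= M &
  forall x y, rnorm (F x - F y) <= M * mdist x y.
Proof.
case: F => F /= /lip_predP[M FM]; exists `|M| => // x y.
by rewrite (le_trans (FM x y))// ler_wpM2r ?mdist_ge0 ?ler_norm.
Qed.

Lemma rnorm_le_sup (F : lip X E) (x : X) : compact [set: X] ->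
  rnorm (F x) <= sup [set rnorm (F x) | x in [set: X]].
Proof.
move=> /(compact_mdist_bounded x)[D xD]; have [M M0 FM] := lip_bound F.
apply: ub_le_sup; last by exists x.
exists (M * D + rnorm (F x)) => _ [y _ <-].
rewrite -{1}[F y](subrK (F x)) (le_trans (ler_rnormD _ _))// lerD2r.
by rewrite (le_trans (FM y x))// ler_wpM2l.
Qed.

Lemma sup_rnorm_le (F : X -> E) (m : R) : [set: X] !=set0 ->
  (forall x, rnorm (F x) <= m) -> sup [set rnorm (F x) | x in [set: X]] <= m.
Proof.
move=> [x _] Fm; apply: ge_sup; first by exists (rnorm (F x)); exists x.
by move=> _ [y _ <-].
Qed.

(** Lets the Lipschitz terms of maps that differ by a constant cancel in [lip_norm]. *)
Lemma eq_lip_const (F G : X -> E) :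
  (forall x y, F x - F y = G x - G y) -> lip_const F = lip_const G.
Proof.
move=> FG; congr sup; apply/seteqP.
by split=> _ [x [y [xy ->]]]; exists x, y; rewrite FG.
Qed.

Lemma lip_cst_subproof (v : E) : (fun _ : X => v) \in lip_pred.
Proof.
by apply/lip_predP; exists 0 => x y; rewrite subrr rnorm0 mul0r.
Qed.

Definition lip_cst (v : E) : lip X E := Lip (lip_cst_subproof v).

Lemma lip_dist_subproof (x0 : X) :
  (fun x => (mdist x x0)%:C%C : R[i]^o) \in lip_pred.
Proof.
apply/lip_predP; exists 1 => x y; rewrite mul1r -lecR rnormE.
rewrite -rmorphB /= normc_def /= expr0n addr0 sqrtr_sqr lecR ler_norml.
have := metric_triangle x y x0; have := metric_triangle y x x0.
by rewrite [mdist y x]metric_sym => ? ?; apply/andP; split; lra.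
Qed.

Definition lip_dist (x0 : X) : lip X R[i]^o := Lip (lip_dist_subproof x0).

Lemma rnorm_complex_le (a b m : R) : 0 <= m -> a ^+ 2 + b ^+ 2 <= m ^+ 2 ->
  rnorm ((a +i* b)%C : R[i]^o) <= m.
Proof.
move=> m0 abm; rewrite -lecR rnormE normc_def lecR /=.
by rewrite -(ger0_norm m0) -sqrtr_sqr ler_wsqrtr.
Qed.

(* The slope K / 2 of the peak absorbs the variation of g. *)
Lemma rnorm_peak_le (g v : E) (z : R[i]) (M K N d : R) : 0 <= d ->
  rnorm g <= M * d -> M <= K / 2 * rnorm v ->
  rnorm (z : R[i]^o) <= N - K * d / 2 ->
  rnorm (g + z *: v) <= N * rnorm v.
Proof.
move=> d0 gM MK zN; rewrite (le_trans (ler_rnormD _ _))// rnormZ.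
have := ler_wpM2r d0 MK.
have := ler_wpM2r (rnorm_ge0 v) zN.
by move: gM; lra.
Qed.

End LipschitzMaps.

Theorem proposition3p6 (R : realType) (X1 X2 : metricType R)
    (E1 E2 : completeNormedModType R[i])
    (X1_neq0 : [set: X1] !=set0) (X2_neq0 : [set: X2] !=set0)
    (X1_compact : compact [set: X1]) (X2_compact : compact [set: X2])
    (U : {linear lip X1 E1 -> lip X2 E2})
    (U_isometry : forall F : lip X1 E1, lip_norm (U F) = lip_norm F)
    (U_surj : forall G : lip X2 E2, exists F : lip X1 E1, U F = G)
    (psi : {linear E1 -> E2})
    (psi_isometry : forall e : E1, `|psi e| = `|e|)
    (psi_surj : forall e : E2, exists e' : E1, psi e' = e)
    (phi : X2 -> X1)
    (phi_isometry : forall y y' : X2, mdist (phi y) (phi y') = mdist y y')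
    (phi_surj : forall x : X1, exists y : X2, phi y = x)
    (U_tensor : forall (f : lip X1 R[i]^o) (e : E1) (y : X2),
      U (lip_tensor f e) y = psi (f (phi y) *: e)) :
  forall (F : lip X1 E1) (y : X2), U F y = psi (F (phi y)).
Proof.
move=> F y0; set x0 := phi y0.
have [e psie] := psi_surj (U F y0 - psi (F x0)).
suff e0 : e = 0 by apply/eqP; rewrite -subr_eq0 -psie e0 linear0.
apply/eqP/negP => /negP e_neq0.
have ne : 0 < rnorm e by rewrite -ltcR rnormE normr_gt0.
have [D x0D] := compact_mdist_bounded x0 X1_compact.
have [M1 M1_ge0 FM] := lip_bound F.
have [M2 M2_ge0 UFM] := lip_bound (U F).
(* Half of this slope, times [rnorm e], absorbs the variation of both [F] and [U F]. *)
pose K : R := 2 * (M1 + M2) / rnorm e.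
have K_ge0 : 0 <= K by rewrite divr_ge0 ?mulr_ge0 ?addr_ge0// ltW.
have KM : K / 2 * rnorm e = M1 + M2 by rewrite /K; field; rewrite gt_eqF.
(* This gives [1 + 2 * t <= s] for every [t = K * mdist x x0], which the quadratic estimates below
   need. *)
pose s : R := 1 + 2 * (K * D).
pose H (c : R[i]) := F + lip_tensor (lip_dist x0) (- (K +i* K)%C *: e)
                       + lip_tensor (lip_cst (1 : R[i]^o)) (c *: e - F x0).
have HE c x : H c x = F x - F x0 + (c - (mdist x x0)%:C%C * (K +i* K)%C) *: e.
  rewrite /H !lipDE /= scale1r scalerA mulrN scalerBl scaleNr.
  by rewrite addrACA [RHS]addrACA [X in _ + X = _]addrC.
(* The extra [1] is the defect [psi e], which appears when [psi (F x0)] is traded for [U F y0]. *)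
have UHE c y : U (H c) y =
    U F y - U F y0 + (1 + c - (mdist y y0)%:C%C * (K +i* K)%C) *: psi e.
  have -> : U F y0 = psi e + psi (F x0) by rewrite psie subrK.
  rewrite /H (linearD U) (linearD U) !lipDE !U_tensor /= scale1r scalerA mulrN.
  rewrite scaleNr -/x0 -phi_isometry.
  rewrite linearN linearB !linearZ /= -addrA scalerBl scalerDl !scale1r opprD.
  rewrite scalerN -[RHS]addrA; congr (_ + _).
  by rewrite [RHS]addrA addrACA addNr add0r [LHS]addrC (addrC (c *: _)).
have rnorm_psi v : rnorm (psi v) = rnorm v by rewrite /rnorm psi_isometry.
have t_ge0 x : 0 <= K * mdist x x0 by rewrite mulr_ge0 ?mdist_ge0.
have t_le x : K * mdist x x0 <= K * D by rewrite ler_wpM2l.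
have KD_ge0 : 0 <= K * D by exact: le_trans (t_ge0 x0) (t_le x0).
have sup_s : sup [set rnorm (H s%:C%C x) | x in [set: X1]] <= s * rnorm e.
  apply: sup_rnorm_le => // x; rewrite HE.
  apply: (rnorm_peak_le (mdist_ge0 _ _) (FM x x0) (K := K)).
  - by rewrite KM lerDl.
  have := t_le x; have := t_ge0 x; set t := K * _ => t_ge t_leD.
  have -> : s%:C%C - (mdist x x0)%:C%C * (K +i* K)%C = ((s - t) +i* (- t))%C.
    by rewrite /t; simpc; congr (_ +i* _)%C => /=; ring.
  (* Squaring leaves [7 * t <= 4 * s], up to a factor [t]. *)
  by apply: rnorm_complex_le; rewrite /s; nra.
have sup_is : s * rnorm e <= sup [set rnorm (H (s *i)%C x) | x in [set: X1]].
  apply: le_trans (rnorm_le_sup (H _) x0 X1_compact).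
  rewrite HE subrr mdistxx mul0r subr0 add0r rnormZ ler_wpM2r ?rnorm_ge0//.
  by rewrite /rnorm normc_def /= expr0n add0r sqrtr_sqr ler_norm.
(* At [y0] the real numbers [1] and [s] add up in full. *)
have supU_s : (s + 1) * rnorm e <=
    sup [set rnorm (U (H s%:C%C) y) | y in [set: X2]].
  apply: le_trans (rnorm_le_sup (U (H _)) y0 X2_compact).
  rewrite UHE subrr mdistxx mul0r subr0 add0r rnormZ rnorm_psi.
  rewrite ler_wpM2r ?rnorm_ge0//.
  by rewrite /rnorm normc_def /= addr0 expr0n addr0 sqrtr_sqr addrC ler_norm.
have supU_is : sup [set rnorm (U (H (s *i)%C) y) | y in [set: X2]] <=
    (s + 2^-1) * rnorm e.
  apply: sup_rnorm_le => // y; rewrite UHE -rnorm_psi.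
  apply: (rnorm_peak_le (mdist_ge0 _ _) (UFM y y0) (K := K)).
  - by rewrite rnorm_psi KM lerDr.
  rewrite -phi_isometry -/x0.
  have := t_le (phi y); have := t_ge0 (phi y); set t := K * _ => t_ge t_leD.
  have -> : 1 + (s *i)%C - (mdist (phi y) x0)%:C%C * (K +i* K)%C
      = ((1 - t) +i* (s - t))%C.
    by rewrite /t; simpc; congr (_ +i* _)%C => /=; ring.
  (* At [t = 0] this reads [1 + s ^+ 2 <= (s + 2^-1) ^+ 2], true since [1 <= s]. *)
  by apply: rnorm_complex_le; rewrite /s; nra.
have lipH : lip_const (H s%:C%C) = lip_const (H (s *i)%C).
  apply: eq_lip_const => x x'; rewrite !HE.
  by rewrite !subrDZ; congr (_ + _ *: _); ring.
have lipUH : lip_const (U (H s%:C%C)) = lip_const (U (H (s *i)%C)).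
  apply: eq_lip_const => y y'; rewrite !UHE.
  by rewrite !subrDZ; congr (_ + _ *: _); ring.
(* Passing from [c = s] to [c = i s] does not lower the sup norm of [H c], but lowers that of
   [U (H c)] by at least [rnorm e / 2]. *)
have := U_isometry (H s%:C%C); have := U_isometry (H (s *i)%C).
rewrite /lip_norm; lra.
Qed.
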